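(* Let $N>2$ be an integer and let $c_0,c_1,\dots,c_N\in\mathbb{R}$ with $c_0\neq 0$ and $c_N\neq 0$. Then there exist $A,B\in\mathbb{R}$ and real numbers $d_0,d_1,\dots,d_{N-2}$ such that, as polynomials in $x$, $$\sum_{n=0}^{N} c_n x^n = (x^2-Ax-B)\,\sum_{n=0}^{N-2} d_n x^n .$$
   Context: All polynomials are over the field $\mathbb{R}$ of real numbers, in one real variable $x$. *)

(* Defs.v *)
From mathcomp Require Export all_boot all_order all_algebra reals.
Set Implicit Arguments.
Unset Strict Implicit.
Unset Printing Implicit Defensive.

(* Main.v *)
Require Import Defs.
From mathcomp Require Import all_boot all_order all_algebra reals.
From mathcomp Require Import complex ring.
Import Order.TTheory GRing.Theory Num.Theory.
Local Open Scope ring_scope.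

(** Every real polynomial of degree at least 2 has a monic quadratic factor.
    By the fundamental theorem of algebra it has a complex root [z].  When
    [z] is not real, its minimal polynomial over the reals,
    [X^2 - 2 (Re z) X + |z|^2], is the factor
    ([nonreal_root_quadratic_dvdp]).  When [z] is real, [X - z] can be divided
    out; the cofactor is still nonconstant, so it has in turn either a
    real root, giving the factor as a product of two linear polynomials, or a
    nonreal one, giving it as before ([quadratic_factor]).  The existence of
    the coefficients [d] is then a matter of counting degrees. *)

Lemma size_quadratic (F : fieldType) (A B : F) :
  size ('X^2 - A *: 'X - B%:P) = 3.
Proof.
rewrite -addrA size_polyDl size_polyXn //.
rewrite (leq_ltn_trans (size_polyD _ _)) // gtn_max !size_polyN.
rewrite (leq_ltn_trans (size_scale_leq _ _)) ?size_polyX //=.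
exact: leq_ltn_trans (size_polyC_leq1 _) _.
Qed.

(** The remainder in the division of [p] by the quadratic is some [b X + a]
    vanishing at [z]; the imaginary part of [b z + a = 0] reads
    [b (Im z) = 0], which forces [b = 0], and then [a = 0]. *)
Lemma nonreal_root_quadratic_dvdp {R : rcfType} {p : {poly R}} {z : R[i]} :
    root (map_poly (real_complex R) p) z -> complex.Im z != 0 ->
  'X^2 - (complex.Re z *+ 2) *: 'X
    - (- (complex.Re z ^+ 2 + complex.Im z ^+ 2))%:P %| p.
Proof.
case: z => x y /= /rootP pz0 y_neq0.
set q := (X in X %| _).
have q_size : size q = 3 by exact: size_quadratic.
have qz0 : (map_poly (real_complex R) q).[Complex x y] = 0.
  rewrite !rmorphB /= map_polyXn map_polyZ /= map_polyX map_polyC !hornerE /=.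
  rewrite expr2; apply/eqP; rewrite eq_complex /=; apply/andP; split; apply/eqP.
    by rewrite !(mul0r, subr0, opprK) expr2 mulr2n mulrDl opprD; ring.
  by rewrite mul0r mulr2n; ring.
have r_size : (size (p %% q)%R <= 2)%N.
  by rewrite -ltnS -[X in (_ < X)%N]q_size ltn_modp -size_poly_eq0 q_size.
have rE : p %% q = (p %% q)`_1 *: 'X + ((p %% q)`_0)%:P.
  apply/polyP => -[|[|i]]; rewrite !coefE /= ?(mulr0, mulr1, add0r, addr0) //.
  by rewrite nth_default // (leq_trans r_size).
have rz0 : (map_poly (real_complex R) (p %% q)).[Complex x y] = 0.
  by move: pz0; rewrite {1}(divp_eq p q) rmorphD rmorphM /= !hornerE qz0 mulr0 add0r.
move: rz0; rewrite rE rmorphD /= map_polyZ /= map_polyX map_polyC !hornerE /=.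
move/eqP; rewrite eq_complex /= !(mul0r, subr0, addr0) => /andP[+ /eqP].
move=> + /eqP; rewrite mulf_eq0 (negbTE y_neq0) orbF => + /eqP b0.
rewrite b0 mul0r add0r => /eqP a0.
by rewrite /dvdp rE b0 a0 scale0r polyC0 addr0.
Qed.

Lemma root_or_quadratic_factor {R : rcfType} {p : {poly R}} :
    (1 < size p)%N ->
  (exists x, root p x) \/ exists A B, 'X^2 - A *: 'X - B%:P %| p.
Proof.
move=> p_size.
have [|z pz0] := closed_rootP (map_poly (real_complex R) p) _.
  by rewrite size_map_poly gtn_eqF.
have [/eqP y0|y_neq0] := boolP (complex.Im z == 0); last first.
  by right; do 2!eexists; exact: nonreal_root_quadratic_dvdp pz0 y_neq0.
left; exists (complex.Re z); case: z => x y /= in pz0 y0 *.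
by rewrite y0 (fmorph_root (real_complex R)) in pz0.
Qed.

Lemma quadratic_factor {R : rcfType} {p : {poly R}} :
  (2 < size p)%N -> exists A B, 'X^2 - A *: 'X - B%:P %| p.
Proof.
move=> p_size.
have [[x /factor_theorem[q pE]]|//] := root_or_quadratic_factor (ltnW p_size).
have q_size : (1 < size q)%N.
  have q_neq0 : q != 0 by apply: contraTneq p_size => q0; rewrite pE q0 mul0r size_poly0.
  by move: p_size; rewrite pE size_Mmonic ?monicXsubC // size_XsubC addn2.
have [[y /factor_theorem[r qE]]|[A [B qdvd]]] := root_or_quadratic_factor q_size.
  exists (x + y), (- (x * y)); rewrite pE qE.
  have -> : 'X^2 - (x + y) *: 'X - (- (x * y))%:P
      = ('X - y%:P) * ('X - x%:P) :> {poly R}.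
    by rewrite -mul_polyC polyCN polyCD polyCM; ring.
  by rewrite -mulrA dvdp_mull.
by exists A, B; rewrite pE dvdp_mulr.
Qed.

Theorem theorem1p1 (R : realType) (N : nat) (c : 'I_N.+1 -> R)
    (hN : (2 < N)%N) (hc0 : c ord0 != 0) (hcN : c ord_max != 0) :
  exists (A B : R) (d : 'I_(N - 2).+1 -> R),
    \sum_(n < N.+1) c n *: 'X^n =
    ('X^2 - A *: 'X - B%:P) * \sum_(n < (N - 2).+1) d n *: 'X^n :> {poly R}.
Proof.
have cE : \sum_(n < N.+1) c n *: 'X^n = \poly_(n < N.+1) c (inord n) :> {poly R}.
  by rewrite poly_def; apply: eq_bigr => n _; rewrite inord_val.
have p_size : size (\poly_(n < N.+1) c (inord n)) = N.+1.
  by apply: size_poly_eq; rewrite (_ : inord N = ord_max) //; apply/val_inj; rewrite /= inordK.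
rewrite cE; set p := \poly_(n < _) _ in p_size *.
have [|A [B /dvdpP[q pE]]] := @quadratic_factor R p; first by rewrite p_size ltnW.
have q_size : (size q <= (N - 2).+1)%N.
  have q_neq0 : q != 0.
    by apply: contra_eq_neq p_size => q0; rewrite pE q0 mul0r size_poly0.
  have Q_neq0 : 'X^2 - A *: 'X - B%:P != 0 :> {poly R}.
    by rewrite -size_poly_eq0 size_quadratic.
  move: p_size; rewrite pE size_mul // size_quadratic addn3 /= => -[qE].
  by rewrite -qE subn2 /= leqSpred.
exists A, B, (fun n => q`_n); rewrite pE mulrC; congr (_ * _).
rewrite -(poly_def _ (nth 0 q)); apply/polyP => i; rewrite coef_poly.
by case: ltnP => // /(leq_trans q_size) /(nth_default 0).
Qed.
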